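(* Let $n,K\in\mathbb{Z}_+$ and let $\mathcal{F}^{(n,K)}$ be the space of all general operator recurrent networks $f_\theta^{(L,K)}:\mathbb{R}^{n\times n}\to\mathbb{R}^n$ of level $K$ and width $n$, with arbitrary depth $L\in\mathbb{Z}_+$ and arbitrary parameters $\theta$. Let $\mathcal{Z}\subset\mathbb{R}^{n\times n}$ be a compact set. Then for $K=2n+1$ the set $\mathcal{F}^{(n,K)}$ (restricted to $\mathcal{Z}$) is dense in $C(\mathcal{Z};\mathbb{R}^n)$.
   Context: A general operator recurrent network of level $K$, depth $L$ and width $n$ is a function $f_\theta:\mathbb{R}^{n\times n}\to\mathbb{R}^n$, $f_\theta(X)=h_L$, where $h_0\in\mathbb{R}^n$ is an initial vector, $h_j=0$ for $j<0$, and for $1\le\ell\le L$ $$h_\ell=b_\theta^{\ell,0}+\sum_{k=1}^K\big(A_\theta^{\ell,k,0}h_{\ell-k}+B_\theta^{\ell,k,0}Xh_{\ell-k}\big)+\phi_\ell\Big[b_\theta^{\ell,1}+\sum_{k=1}^K\big(A_\theta^{\ell,k,1}h_{\ell-k}+B_\theta^{\ell,k,1}Xh_{\ell-k}\big)\Big].$$ Here $b_\theta^{\ell,i}\in\mathbb{R}^n$ and $A_\theta^{\ell,k,i},B_\theta^{\ell,k,i}\in\mathbb{R}^{n\times n}$ ($i=0,1$) are determined by the parameters: $b^{\ell,i}_\theta=\theta_0^{\ell,i,0}$, $A_\theta^{\ell,k,i}=A^{\ell,k,i,(0)}+\sum_{p=1}^n\theta_{2p-1}^{\ell,i,k}(\theta_{2p}^{\ell,i,k})^T$,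 $B_\theta^{\ell,k,i}=B^{\ell,k,i,(0)}+\sum_{p=n+1}^{2n}\theta_{2p-1}^{\ell,i,k}(\theta_{2p}^{\ell,i,k})^T$, with fixed matrices $A^{\ell,k,i,(0)},B^{\ell,k,i,(0)}$ and arbitrary vectors $\theta_p^{\ell,i,k}\in\mathbb{R}^n$ (so the biases and weight matrices can be arbitrary). The activation functions $\phi_\ell$ act componentwise by a leaky rectifier $y\mapsto\max(y,\eta_\ell y)$ with some $\eta_\ell\in[0,1]$; $\eta_\ell=0$ is the standard ReLU. $C(\mathcal{Z};\mathbb{R}^n)$ carries the supremum norm. *)

(* Defs.v *)
From HB Require Import structures.
From mathcomp Require Import all_boot all_order all_algebra.
From mathcomp Require Import all_classical all_reals all_analysis.
Set Implicit Arguments.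
Unset Strict Implicit.
Unset Printing Implicit Defensive.
Import Order.TTheory GRing.Theory Num.Theory.
Import numFieldNormedType.Exports.
Local Open Scope classical_set_scope.
Local Open Scope ring_scope.

Section Network.
Variables (R : realType) (n : nat).

Definition leaky (eta y : R) : R := Num.max y (eta * y).

(* The vector theta_p^{l,i,k} is [theta l i k p].  Parameters and fixed data are
   families over all of nat; a network of level K and depth L only reads the
   entries with 1 <= l <= L, i <= 1, k <= K and p <= 4n. *)
Definition params := nat -> nat -> nat -> nat -> 'cV[R]_n.

(* [A0 l k i] is the fixed matrix A^{l,k,i,(0)}, and similarly for [B0]. *)
Definition base_mx := nat -> nat -> nat -> 'M[R]_n.

Definition bias (theta : params) (l i : nat) : 'cV[R]_n := theta l i 0 0.

Definition Aweight (A0 : base_mx) (theta : params) (l k i : nat) : 'M[R]_n :=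
  A0 l k i + \sum_(1 <= p < n.+1)
    theta l i k (2 * p - 1)%N *m (theta l i k (2 * p)%N)^T.

Definition Bweight (B0 : base_mx) (theta : params) (l k i : nat) : 'M[R]_n :=
  B0 l k i + \sum_(n.+1 <= p < (2 * n).+1)
    theta l i k (2 * p - 1)%N *m (theta l i k (2 * p)%N)^T.

Variables (h0 : 'cV[R]_n) (eta : nat -> R) (A0 B0 : base_mx).

(* The affine expression of index i in layer l, where [prev k] is h_{l-k}. *)
Definition preact (K : nat) (theta : params) (X : 'M[R]_n) (l i : nat)
    (prev : nat -> 'cV[R]_n) : 'cV[R]_n :=
  bias theta l i + \sum_(1 <= k < K.+1)
    (Aweight A0 theta l k i *m prev k + Bweight B0 theta l k i *m (X *m prev k)).

Definition layer (K : nat) (theta : params) (X : 'M[R]_n) (l : nat)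
    (prev : nat -> 'cV[R]_n) : 'cV[R]_n :=
  preact K theta X l 0 prev + map_mx (leaky (eta l)) (preact K theta X l 1 prev).

(* [history K theta X l k] is h_{l-k}, with value 0 when k > l. *)
Fixpoint history (K : nat) (theta : params) (X : 'M[R]_n) (l : nat) :
    nat -> 'cV[R]_n :=
  match l with
  | 0 => fun k => if k == 0%N then h0 else 0
  | l'.+1 => fun k =>
      if k is k'.+1 then history K theta X l' k'
      else layer K theta X l'.+1 (fun j => history K theta X l' j.-1)
  end.

Definition hidden (K : nat) (theta : params) (X : 'M[R]_n) (l : nat) :=
  history K theta X l 0.

Definition network (L K : nat) (theta : params) (X : 'M[R]_n) : 'cV[R]_n :=
  hidden K theta X L.

Lemma historyE K theta X l k :
  history K theta X l k = if (k <= l)%N then hidden K theta X (l - k) else 0.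
Proof.
rewrite /hidden; elim: l k => [|l IH] [|k] //.
by rewrite ltnS subSS -IH.
Qed.

Lemma hidden0 K theta X : hidden K theta X 0 = h0.
Proof. by []. Qed.

Lemma hiddenE K theta X l : (0 < l)%N ->
  let prev k := if (k <= l)%N then hidden K theta X (l - k) else 0 in
  hidden K theta X l =
    (bias theta l 0 + \sum_(1 <= k < K.+1)
       (Aweight A0 theta l k 0 *m prev k
        + Bweight B0 theta l k 0 *m (X *m prev k)))
    + map_mx (leaky (eta l))
    (bias theta l 1 + \sum_(1 <= k < K.+1)
       (Aweight A0 theta l k 1 *m prev k
        + Bweight B0 theta l k 1 *m (X *m prev k))).
Proof.
case: l => // l _ prev; rewrite {1}/hidden /= /layer /preact.
have E i : \sum_(1 <= k < K.+1)
    (Aweight A0 theta l.+1 k i *m history K theta X l k.-1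
     + Bweight B0 theta l.+1 k i *m (X *m history K theta X l k.-1)) =
  \sum_(1 <= k < K.+1)
    (Aweight A0 theta l.+1 k i *m prev k
     + Bweight B0 theta l.+1 k i *m (X *m prev k)).
  apply: eq_big_nat => -[|k] // _; rewrite /= historyE /prev.
  by rewrite ltnS subSS.
by rewrite !E.
Qed.

Lemma cvg_mxP (T : Type) (F : set_system T) (FF : Filter F) p q
    (f : T -> 'M[R]_(p, q)) (M : 'M[R]_(p, q)) :
  (forall i j, (fun t => f t i j) @ F --> M i j) -> f @ F --> M.
Proof.
move=> H; apply/cvg_ballP => e e0.
have Hij : \forall t \near F, forall ij : 'I_p * 'I_q,
    ball (M ij.1 ij.2) e (f t ij.1 ij.2).
  apply: filter_forall => -[i j]; exact: (cvg_ball (H i j) e0).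
by apply: filterS Hij => t Ht; split => // i j; exact: (Ht (i, j)).
Qed.

Lemma cvg_bigsum (T I : Type) (F : set_system T) (FF : Filter F)
    (V : normedModType R) (s : seq I) (f : T -> I -> V) (v : I -> V) :
  (forall k, f ^~ k @ F --> v k) ->
  (fun t => \sum_(k <- s) f t k) @ F --> \sum_(k <- s) v k.
Proof.
move=> H; elim: s => [|k s IH].
  by under eq_fun do rewrite big_nil; rewrite big_nil; exact: cvg_cst.
under eq_fun do rewrite big_cons.
by rewrite big_cons; apply: cvgD => //; exact: H.
Qed.

Lemma continuous_mulmx (T : topologicalType) p q r
    (f : T -> 'M[R]_(p, q)) (g : T -> 'M[R]_(q, r)) :
  continuous f -> continuous g -> continuous (fun t => f t *m g t).
Proof.
move=> cf cg t; apply: cvg_mxP => i j; rewrite mxE.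
under eq_fun do rewrite mxE.
apply: cvg_bigsum => k; apply: cvgM.
- exact: (continuous_comp (cf t) (@coord_continuous _ _ _ i k _)).
- exact: (continuous_comp (cg t) (@coord_continuous _ _ _ k j _)).
Qed.

Lemma cst_cts (T U : topologicalType) (c : U) : continuous (fun _ : T => c).
Proof. by move=> x; exact: cvg_cst. Qed.

Lemma ctsD (T : topologicalType) (V : normedModType R) (f g : T -> V) :
  continuous f -> continuous g -> continuous (fun t => f t + g t).
Proof. by move=> cf cg t; apply: cvgD; [exact: cf|exact: cg]. Qed.

Lemma cts_bigsum (T : topologicalType) (I : Type) (V : normedModType R)
    (s : seq I) (f : T -> I -> V) :
  (forall k, continuous (f ^~ k)) ->
  continuous (fun t => \sum_(k <- s) f t k).
Proof. by move=> cf t; apply: cvg_bigsum => k; exact: cf. Qed.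

Lemma cts_leaky (T : topologicalType) (e : R) p q (f : T -> 'M[R]_(p, q)) :
  continuous f -> continuous (fun t => map_mx (leaky e) (f t)).
Proof.
move=> cf t; apply: cvg_mxP => i j; rewrite mxE.
under eq_fun do rewrite mxE.
have c : {for t, continuous (fun t => f t i j)}.
  exact: (continuous_comp (cf t) (@coord_continuous _ _ _ i j _)).
apply: (@continuous_max R T (fun t => f t i j) (fun t => e * f t i j)) => //.
by apply: cvgM => //; exact: cvg_cst.
Qed.

Lemma continuous_preact K theta l i (prev : 'M[R]_n -> nat -> 'cV[R]_n) :
  (forall k, continuous (prev^~ k)) ->
  continuous (fun X => preact K theta X l i (prev X)).
Proof.
move=> cp; apply: ctsD; first exact: cst_cts.
apply: cts_bigsum => k; apply: ctsD.
- by apply: continuous_mulmx => //; exact: cst_cts.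
- apply: continuous_mulmx; first exact: cst_cts.
  by apply: continuous_mulmx => // Y; exact: cvg_id.
Qed.

Lemma continuous_history K theta l k :
  continuous (fun X => history K theta X l k).
Proof.
elim: l k => [|l IH] [|k] /=; try exact: cst_cts; last exact: IH.
have cp i := continuous_preact (K := K) (theta := theta) (l := l.+1) (i := i)
  (fun k => IH k.-1).
by apply: ctsD; [|apply: cts_leaky]; exact: cp.
Qed.

Lemma continuous_network L K theta : continuous (network L K theta).
Proof. exact: continuous_history. Qed.

HB.instance Definition _ L K theta :=
  @isContinuous.Build _ _ (network L K theta) (@continuous_network L K theta).

Definition recurrent_networks (K : nat) : set (continuousType 'M[R]_n 'cV[R]_n) :=
  [set f : continuousType 'M[R]_n 'cV[R]_n |
    exists L theta, (0 < L)%N /\ (f : 'M[R]_n -> 'cV[R]_n) = network L K theta].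

End Network.

Definition restrict_cts (X Y : topologicalType) (Z : set X)
    (f : continuousType X Y) : continuousType Z Y :=
  mkcts (fun z : Z => continuous_comp (@initial_continuous _ _ set_val z)
                                      (@cts_fun _ _ f (set_val z))).

Lemma restrict_ctsE (X Y : topologicalType) (Z : set X)
    (f : continuousType X Y) (z : Z) : restrict_cts Z f z = f (set_val z).
Proof. by []. Qed.

(* Turns C(X; Y) into a uniform space whose topology is that of uniform
   convergence, i.e. of the supremum norm when X is compact. *)
Export ArrowAsUniformType.

Lemma dense_ctsP (R : realType) (X : topologicalType) (V : normedModType R)
    (F : set (continuousType X V)) :
  dense F <-> forall (f : continuousType X V) (e : R), 0 < e ->
    exists2 g, F g & forall x, `|f x - g x| < e.
Proof.
split=> [dF f e e0|H O [f Of] oO].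
  pose B := [set g : X -> V | forall x, ball (f x) e (g x)].
  have nB : nbhs (f : X -> V) B by exact: (nbhsx_ballx (f : X -> V) e e0).
  have nf : nbhs f ((fun g : continuousType X V => (g : X -> V)) @^-1` B).
    exact: (@initial_continuous _ _ (fun g : continuousType X V => (g : X -> V)) f).
  have [g [/interior_subset Bg Fg]] := dF _ (ex_intro _ f nf) (@open_interior _ _).
  by exists g => // x; move: (Bg x); rewrite -ball_normE.
move: oO Of => [B oB <-] /= Bf.
have /nbhs_ballP[e /= e0 eB] : nbhs (f : X -> V) B by exact: open_nbhs_nbhs.
have [g Fg fg] := H f e e0.
by exists g; split => //; apply: eB => x; rewrite -ball_normE; exact: fg.
Qed.

(* Main.v *)
Require Import Defs.
From HB Require Import structures.
From mathcomp Require Import all_boot all_order all_algebra.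
From mathcomp Require Import all_classical all_reals all_analysis.
From mathcomp Require Import ring lra.
Import Order.TTheory GRing.Theory Num.Theory.
Import numFieldNormedType.Exports.
Local Open Scope classical_set_scope.
Local Open Scope ring_scope.

(** The networks compute every polynomial map in the entries of X, and the
polynomial maps are dense by the Stone-Weierstrass theorem.

A network is able to multiply because its layers contain the products X h, and
h may itself depend on X: if h = c *: delta_mx j 0, then selecting row i of X h
gives c * X i j.  Hence a scalar held in one coordinate can be multiplied by
any entry of X, and a monomial is obtained after finitely many layers.  The
activations are made harmless for every slope by giving the argument of the
rectifier the value 0; a layer is then affine in the previous hidden vectors
and in their products with X.  Any prescribed affine layer is available, since
an n x n matrix is a sum of n outer products (sum_outer_products), and so the
outer products of the parameters can correct whatever the fixed matrices are.

Sums need memory: the even layers hold an accumulator and the odd layers hold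
the vector on which the current monomial is being built.  Each of the two is
carried over from two layers before, and the accumulator also reads the layer
just before it, so that lags 1 and 2 suffice and any level K > 1 works
(network_polynomial); K = 2 * n + 1 is such a level because n > 0.  The
accumulator starts at h0, so a target f is reached by approximating f - h0 by
a polynomial map.

The density of polynomials in C(Z; R) is the real Stone-Weierstrass theorem
(stone_weierstrass), proved in the classical way: polynomials converging to a
square root uniformly on [0, 1] put |f| in the uniform closure of the algebra,
which is therefore closed under maxima; functions matching the target at two
prescribed points are then glued by compactness, from below and from above. *)

Set Implicit Arguments.
Unset Strict Implicit.

(** * Uniform closure of a set of real functions *)

Section UniformClosure.
Context {T : Type} {R : realType}.
Implicit Types (A : set (T -> R)) (f g : T -> R).

Definition uniform_closure A : set (T -> R) :=
  [set f | forall e : R, 0 < e -> exists2 g, A g & forall x, `|f x - g x| < e].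

Let half_gt0 (e : R) : 0 < e -> 0 < e / 2.
Proof. by move=> e0; rewrite divr_gt0. Qed.

Lemma uniform_closureS A f : A f -> uniform_closure A f.
Proof. by move=> Af e e0; exists f => // x; rewrite subrr normr0. Qed.

Lemma uniform_closureK A :
  uniform_closure (uniform_closure A) `<=` uniform_closure A.
Proof.
move=> f cf e e0; have [g cg fg] := cf (e / 2) (half_gt0 e0).
have [h Ah gh] := cg (e / 2) (half_gt0 e0).
exists h => // x; rewrite [ltRHS]splitr.
by rewrite (le_lt_trans (ler_distD (g x) _ _))// ltrD.
Qed.

Lemma uniform_closureD A : (forall f g, A f -> A g -> A (f \+ g)) ->
  forall f g, uniform_closure A f -> uniform_closure A g ->
  uniform_closure A (f \+ g).
Proof.
move=> AD f g cf cg e e0; have [f' Af ff] := cf (e / 2) (half_gt0 e0).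
have [g' Ag gg] := cg (e / 2) (half_gt0 e0).
exists (f' \+ g') => [|x]; first exact: AD.
rewrite [ltRHS]splitr /= opprD addrACA.
by rewrite (le_lt_trans (ler_normD _ _))// ltrD.
Qed.

Lemma uniform_closureZ A : (forall (c : R) f, A f -> A (fun x => c * f x)) ->
  forall (c : R) f, uniform_closure A f -> uniform_closure A (fun x => c * f x).
Proof.
move=> AZ c f cf e e0.
have c0 : 0 < `|c| + 1 by rewrite ltr_wpDl.
have [g Ag fg] := cf (e / (`|c| + 1)) (divr_gt0 e0 c0).
exists (fun x => c * g x) => [|x]; first exact: AZ.
rewrite -mulrBr normrM; have := fg x; rewrite ltr_pdivlMr// => {}fg.
apply: le_lt_trans fg; rewrite mulrC ler_wpM2l//.
by rewrite lerDl.
Qed.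

End UniformClosure.

(** * Polynomial approximation of the square root *)

Section SquareRoot.
Context {R : realType}.

(** The iteration q |-> q + (u - q^2) / 2, started at 0, increases to the square
root of u on [0, 1]; its k-th term is a polynomial in u. *)
Fixpoint sqrt_approx (k : nat) (u : R) : R :=
  if k is j.+1 then sqrt_approx j u + 2^-1 * (u - sqrt_approx j u ^+ 2) else 0.

(** Each step multiplies the error t - q by 1 - (t + q) / 2 <= 1 - t / 2, and
(1 - t / 2) (1 + (k + 1) t / 2) <= 1 + k t / 2, so that the weighted error in
the third conclusion never grows. *)
Lemma sqrt_approx_bounds k (t : R) : 0 <= t <= 1 ->
  [/\ 0 <= sqrt_approx k (t ^+ 2), sqrt_approx k (t ^+ 2) <= t
    & (t - sqrt_approx k (t ^+ 2)) * (1 + k%:R * t / 2) <= t].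
Proof.
move=> /andP[t0 t1]; elim: k => [|k [q0 qt qk]] /=; first by split => //; lra.
move: (sqrt_approx k _) q0 qt qk => q q0 qt qk.
have k0 : 0 <= k%:R :> R by [].
have step : t - (q + 2^-1 * (t ^+ 2 - q ^+ 2)) = (t - q) * (1 - (t + q) / 2).
  by field.
split.
- by rewrite addr_ge0// mulr_ge0// subr_ge0 ler_sqr// nnegrE.
- by rewrite -subr_ge0 step mulr_ge0//; lra.
- rewrite step; apply: le_trans qk; rewrite -mulrA ler_wpM2l ?subr_ge0//.
  rewrite -[k.+1]addn1 natrD; move: (k%:R : R) k0 => c c0.
  apply: (@le_trans _ _ ((1 - t / 2) * (1 + (c + 1) * t / 2))).
    by rewrite ler_wpM2r//; [nra|lra].
  by nra.
Qed.

(** The weighted bound of sqrt_approx_bounds gives (t - q) k t / 2 <= t, and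
dividing by t makes the estimate uniform in t, down to t = 0. *)
Lemma sqrt_approx_le k (t : R) : 0 <= t <= 1 ->
  `|t - sqrt_approx k (t ^+ 2)| * k%:R <= 2.
Proof.
move=> t01; have [q0 qt qk] := sqrt_approx_bounds k t01.
rewrite ger0_norm ?subr_ge0//; move: (sqrt_approx _ _) q0 qt qk => q q0 qt qk.
have k0 : 0 <= k%:R :> R by []; move: (k%:R : R) k0 qk => c c0 qk.
move: t01 => /andP[t0 t1].
have [t_eq0|t_neq0] := eqVneq t 0.
  have -> : t - q = 0 by lra.
  by rewrite mul0r.
have {t_neq0} t_gt0 : 0 < t by rewrite lt_neqAle eq_sym t_neq0.
by rewrite -(ler_pM2r t_gt0); nra.
Qed.

End SquareRoot.

(** * The Stone-Weierstrass theorem *)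

Section StoneWeierstrass.
Context {T : topologicalType} {R : realType}.
Hypothesis compactT : compact [set: T].
Implicit Types (S : set (T -> R)) (f g h : T -> R).

(** An upward directed family that beats f at each point has a single member
beating f everywhere.  Compactness is used in its near-covering form, for the
filter of tails of the directed family: f < g at x persists near x and for all
members above g. *)
Lemma compact_directed_dominate S f :
  continuous f -> (forall h, S h -> continuous h) -> S !=set0 ->
  (forall g h, S g -> S h -> S (g \max h)) ->
  (forall x, exists2 h, S h & f x < h x) ->
  exists2 h, S h & forall x, f x < h x.
Proof.
move=> cf cS S0 Smax fS.
pose F := filter_from S (fun g => [set h | S h /\ forall x, g x <= h x]).
have FF : ProperFilter F.
  apply: filter_from_proper; last by move=> g Sg; exists g.
  apply: filter_from_filter => // g h Sg Sh.
  exists (g \max h); first exact: Smax.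
  by move=> k [Sk ghk]; split; split=> // x;
    apply: le_trans (ghk x); rewrite /= le_max lexx ?orbT.
have /compact_near_coveringP/(_ _ F (fun h x => f x < h x)) := compactT.
have : F S by case: S0 => g Sg; exists g => // h [].
move=> FS /(_ _) H.
suff : \near F, [set: T] `<=` (fun x => f x < F x).
  by move=> /(filterI FS)/filter_ex[h [Sh fh]]; exists h => // x; exact: fh.
apply: H => x _; have [g Sg fgx] := fS x.
have Ng : nbhs x [set y | f y < g y].
  have gf : (fun y => g y - f y) @ x --> g x - f x.
    by apply: cvgB; [exact: cS|exact: cf].
  apply: filterS (cvgr_gt _ gf 0 _); last by rewrite subr_gt0.
  by move=> y /=; rewrite subr_gt0.
exists ([set y | f y < g y], [set h | S h /\ forall x, g x <= h x]) => /=.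
  by split=> //; exists g.
by move=> [y h] /= [fgy [_ gh]]; exact: lt_le_trans (gh y).
Qed.

Variable A : set (T -> R).
Hypothesis A_continuous : forall f, A f -> continuous f.
Hypothesis A_cst : forall c, A (fun=> c).
Hypothesis A_add : forall f g, A f -> A g -> A (f \+ g).
Hypothesis A_mul : forall f g, A f -> A g -> A (f \* g).
Hypothesis A_separates : forall x y, x <> y -> exists2 f, A f & f x != f y.

Let A_scale c f : A f -> A (fun x => c * f x).
Proof. by move=> Af; apply: (A_mul (A_cst c) Af). Qed.

Let A_opp f : A f -> A (fun x => - f x).
Proof.
by move=> /(A_scale (-1)); congr (A _); apply/funext => x; rewrite mulN1r.
Qed.

(** With M a bound of |g|, the function |g| equals M sqrt((g / M)^2), and
polynomials in g belong to the algebra. *)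
Lemma uniform_closure_norm f :
  uniform_closure A f -> uniform_closure A (fun x => `|f x|).
Proof.
move=> cf; apply: uniform_closureK => e e0; have [g Ag fg] := cf e e0.
exists (fun x => `|g x|); last first.
  by move=> x; apply: le_lt_trans (fg x); exact: ler_dist_dist.
move=> {f cf e e0 fg} e e0.
have [M M0 gM] : exists2 M, 0 < M & forall x, `|g x| < M.
  have : bounded_set (g @` setT).
    apply: compact_bounded; apply: continuous_compact => //.
    exact/continuous_subspaceT/A_continuous.
  move=> /ex_strict_bound_gt0[M M0 gM]; exists M => // x.
  by apply: gM; exists x.
(* The error of the k-th iterate is at most 2 * M / k, which is below e. *)
pose k := (Num.truncn (2 * M / e)).+1.
have A_sqrt j : A (fun x => sqrt_approx j ((M^-1 * g x) ^+ 2)).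
  elim: j => [|j IH] /=; first exact: A_cst.
  apply: A_add => //; apply: A_scale.
  apply: A_add; first by apply: A_mul; exact: A_scale.
  exact: A_opp (A_mul IH IH).
exists (fun x => M * sqrt_approx k ((M^-1 * g x) ^+ 2)); first exact: A_scale.
move=> x; pose t := `|g x| / M.
have t01 : 0 <= t <= 1.
  by rewrite divr_ge0 ?(ltW M0)//= ler_pdivrMr// mul1r ltW.
have -> : (M^-1 * g x) ^+ 2 = t ^+ 2.
  by rewrite /t !exprMn real_normK ?num_real// mulrC.
have -> : `|g x| = M * t by rewrite /t mulrC divfK ?gt_eqF.
rewrite -mulrBr normrM (gtr0_norm M0).
have k0 : 0 < k%:R :> R by rewrite ltr0n.
rewrite -(ltr_pM2r k0) -mulrA.
apply: (@le_lt_trans _ _ (M * 2)).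
  by rewrite ler_pM2l// sqrt_approx_le.
have : 2 * M / e < k%:R by exact: truncnS_gt.
by rewrite ltr_pdivrMr// [2 * M]mulrC [k%:R * e]mulrC.
Qed.

Lemma uniform_closure_max f g : uniform_closure A f -> uniform_closure A g ->
  uniform_closure A (f \max g).
Proof.
move=> cf cg; have cD := uniform_closureD A_add; have cZ := uniform_closureZ A_scale.
suff -> : f \max g =
    (fun x => 2^-1 * ((f \+ g) x + `|(f \+ (fun y => (- 1) * g y)) x|)).
  apply: (cZ _ (fun x => _ x + `| _ |)).
  apply: (cD (f \+ g) (fun x => `| _ |)); first exact: cD.
  by apply: uniform_closure_norm; apply: (cD _ _ cf); exact: cZ.
by apply/funext => x /=; rewrite mulN1r maxr_absE mulrC.
Qed.

(** For each x, functions through (x, f x) and (y, f y) are glued into one lying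
above f - e everywhere and below f + e at x.  The negatives of these functions
are then glued in the same way to dominate - f - e everywhere. *)
Theorem stone_weierstrass f : continuous f -> uniform_closure A f.
Proof.
move=> cf; apply: uniform_closureK => e e0.
have clS h : A h -> uniform_closure A h by exact: uniform_closureS.
have interp x y : exists2 h, A h & h x = f x /\ h y = f y.
  have [->|/A_separates[g Ag gxy]] := pselect (x = y).
    by exists (fun=> f y).
  pose c := (f y - f x) / (g y - g x).
  exists (fun z => (f x - c * g x) + c * g z).
    by apply: (A_add (A_cst _)); exact: A_scale.
  split; first by ring.
  rewrite /c; field; by rewrite subr_eq0 eq_sym.
have upper x : exists2 h, [/\ uniform_closure A h, continuous h & h x < f x + e]
    & forall y, f y - e < h y.
  pose S h := [/\ uniform_closure A h, continuous h & h x < f x + e].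
  apply: (@compact_directed_dominate S (fun y => f y - e)).
  - by move=> y; apply: cvgB; [exact: cf|exact: cvg_cst].
  - by move=> h [].
  - exists (fun=> f x); split; [exact/clS|by move=> y; exact: cvg_cst|].
    by rewrite ltrDl.
  - move=> g h [cg ctg gx] [ch cth hx]; split.
    + exact: uniform_closure_max.
    + by move=> y; exact: (@continuous_max R T g h y (ctg y) (cth y)).
    + by rewrite /= gt_max gx.
  - move=> y; have [h Ah [hx hy]] := interp x y.
    exists h; last by rewrite hy gtrBl.
    by split; [exact: clS|exact: A_continuous|rewrite hx ltrDl].
pose S h := [/\ uniform_closure A h, continuous h & forall y, h y < e - f y].
have opp_S h : uniform_closure A h -> continuous h ->
    (forall y, f y - e < h y) -> S (fun y => (- 1) * h y).
  move=> ch cth fh; split; first by apply: uniform_closureZ.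
    by move=> y; apply: cvgM; [exact: cvg_cst|exact: cth].
  by move=> y; rewrite mulN1r ltrNl opprB.
have [|||||h [ch cth hf] fh] := @compact_directed_dominate S (fun y => - e - f y).
- by move=> y; apply: cvgB; [exact: cvg_cst|exact: cf].
- by move=> h [].
- have [[x _]|T0] := pselect (exists x : T, True).
    by have [h [ch cth _] fh] := upper x; exists (fun y => (- 1) * h y); exact: opp_S.
  exists (fun=> 0); split=> [|y|y]; [exact/clS|exact: cvg_cst|].
  by case: T0; exists y.
- move=> g h [cg ctg gf] [ch cth hf]; split.
  + exact: uniform_closure_max.
  + by move=> y; exact: (@continuous_max R T g h y (ctg y) (cth y)).
  + by move=> y; rewrite /= gt_max gf hf.
- move=> x; have [h [ch cth hx] fh] := upper x.
  exists (fun y => (- 1) * h y); first exact: opp_S.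
  by rewrite mulN1r -opprD ltrN2 addrC.
exists (fun y => (- 1) * h y); first by apply: uniform_closureZ.
by move=> x; rewrite mulN1r opprK ltr_norml; have := hf x; have := fh x; lra.
Qed.

End StoneWeierstrass.

(** * Parameters realizing prescribed biases and weights *)

Section Weights.
Context {R : realType} {n : nat}.
Variables (A0 B0 : base_mx R n).

(** Columns are indexed by nat because the parameters of a network are; the
value 0 beyond n is never reached. *)
Definition nth_col (M : 'M[R]_n) (q : nat) : 'cV[R]_n :=
  if insub q is Some j then col j M else 0.

Lemma sum_outer_products (M : 'M[R]_n) :
  \sum_(0 <= q < n) nth_col M q *m (nth_col 1%:M q)^T = M.
Proof.
rewrite big_mkord; under eq_bigr do rewrite /nth_col valK.
apply/matrixP => i j; rewrite summxE (bigD1 j)//= big1 => [|k kj].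
  by rewrite addr0 mxE big_ord1 !mxE eqxx mulr1.
by rewrite mxE big_ord1 !mxE eq_sym (negbTE kj) mulr0.
Qed.

(** The outer product of index p >= 1 uses the entries 2p-1 = 2r+1 and 2p = 2r+2,
where r = p-1; these are q.+1 for q = 2r and q = 2r+1, so r = q./2 and the
parity of q tells the left factor from the right one.  The range r < n serves
the weight A and n <= r < 2n serves B. *)
Definition encode (b : nat -> nat -> 'cV[R]_n) (A B : base_mx R n) : params R n :=
  fun l i k p => if p is q.+1 then
    let low := (q./2 < n)%N in
    nth_col (if odd q then 1%:M
             else if low then A l k i - A0 l k i else B l k i - B0 l k i)
            (if low then q./2 else (q./2 - n)%N)
  else b l i.

Variables (b : nat -> nat -> 'cV[R]_n) (A B : base_mx R n).

Lemma bias_encode l i : bias (encode b A B) l i = b l i. Proof. by []. Qed.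

Let encode_outer l i k r :
  encode b A B l i k (2 * r.+1 - 1)%N *m (encode b A B l i k (2 * r.+1)%N)^T =
  nth_col (if (r < n)%N then A l k i - A0 l k i else B l k i - B0 l k i)
      (if (r < n)%N then r else (r - n)%N) *m
    (nth_col 1%:M (if (r < n)%N then r else (r - n)%N))^T.
Proof.
have -> : (2 * r.+1 - 1)%N = r.*2.+1 by rewrite mul2n doubleS subn1.
have -> : (2 * r.+1)%N = r.*2.+2 by rewrite mul2n doubleS.
by rewrite /encode /= odd_double doubleK uphalf_double.
Qed.

Lemma Aweight_encode l k i : Aweight A0 (encode b A B) l k i = A l k i.
Proof.
rewrite /Aweight big_add1 /=.
under eq_big_nat => r /andP[_ rn] do rewrite encode_outer rn.
by rewrite sum_outer_products subrKC.
Qed.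

Lemma Bweight_encode l k i : Bweight B0 (encode b A B) l k i = B l k i.
Proof.
rewrite /Bweight big_add1 [X in _ + X](@big_addn _ _ _ 0 (2 * n) n).
rewrite mul2n -addnn addnK.
under eq_bigr => r _ do rewrite encode_outer ltnNge leq_addl addnK.
by rewrite sum_outer_products subrKC.
Qed.

End Weights.

(** * Networks as two-register machines *)

Section Programs.
Context {R : realType} {n : nat}.

(** One instruction drives an odd layer, which rewrites the work vector by
reset, keep and mulX, and then an even layer, which adds the image of the new
work vector by emit to the accumulator. *)
Record instruction := Instruction {
  reset : 'cV[R]_n; keep : 'M[R]_n; mulX : 'M[R]_n; emit : 'M[R]_n }.

Definition skip := Instruction 0 0 0 0.

Definition step (X : 'M[R]_n) (s : 'cV[R]_n * 'cV[R]_n) (c : instruction) :=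
  let w := reset c + keep c *m s.2 + mulX c *m (X *m s.2) in
  (s.1 + emit c *m w, w).

Definition program_bias (c : nat -> instruction) (l i : nat) : 'cV[R]_n :=
  if (i == 0%N) && odd l then reset (c l.-1./2) else 0.

Definition program_A (c : nat -> instruction) : base_mx R n := fun l k i =>
  match i, k with
  | 0, 1 => if odd l then 0 else emit (c l.-1./2)
  | 0, 2 => if odd l then keep (c l.-1./2) else 1%:M
  | _, _ => 0
  end.

Definition program_B (c : nat -> instruction) : base_mx R n := fun l k i =>
  match i, k with
  | 0, 2 => if odd l then mulX (c l.-1./2) else 0
  | _, _ => 0
  end.

Variables (h0 : 'cV[R]_n) (eta : nat -> R) (A0 B0 : base_mx R n) (K : nat).
Hypothesis K_gt1 : (1 < K)%N.

Definition program_params (c : nat -> instruction) : params R n :=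
  encode A0 B0 (program_bias c) (program_A c) (program_B c).

(** The argument of the rectifier is 0, where every leaky rectifier vanishes, and
the only nonzero weights are those of lags 1 and 2. *)
Lemma layer_program c X l (prev : nat -> 'cV[R]_n) :
  layer eta A0 B0 K (program_params c) X l prev =
  program_bias c l 0 + (program_A c l 1 0 *m prev 1 +
    (program_A c l 2 0 *m prev 2 + program_B c l 2 0 *m (X *m prev 2))).
Proof.
rewrite /layer /preact !bias_encode.
have -> : map_mx (leaky (eta l)) (program_bias c l 1 + \sum_(1 <= k < K.+1)
    (Aweight A0 (program_params c) l k 1 *m prev k +
     Bweight B0 (program_params c) l k 1 *m (X *m prev k))) = 0.
  rewrite big1 => [|k _]; last first.
    by rewrite Aweight_encode Bweight_encode !mul0mx addr0.
  by apply/matrixP => i j; rewrite !mxE /leaky addr0 mulr0 maxxx.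
rewrite addr0; congr (_ + _).
under eq_bigr do rewrite Aweight_encode Bweight_encode.
rewrite (big_cat_nat (n := 3))//= big_ltn// big_nat1 [X in _ + X]big1_seq ?addr0.
  by rewrite mul0mx addr0.
move=> [|[|[|k]]] //=; rewrite ?mem_index_iota// => _.
by rewrite !mul0mx addr0.
Qed.

(** After t instructions the two most recent hidden vectors are the two
registers.  The initial ones are h0 and 0, because h_{-1} = 0. *)
Lemma history_program c X t :
  history h0 eta A0 B0 K (program_params c) X t.*2 0 =
    (foldl (step X) (h0, 0) (mkseq c t)).1 /\
  history h0 eta A0 B0 K (program_params c) X t.*2 1 =
    (foldl (step X) (h0, 0) (mkseq c t)).2.
Proof.
pose H := history h0 eta A0 B0 K (program_params c) X.
have layerE l : H l.+1 0 = layer eta A0 B0 K (program_params c) X l.+1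
  (fun k => H l k.-1) by [].
rewrite -/H; elim: t => [//|t [IH1 IH2]]; rewrite doubleS mkseqS foldl_rcons.
have odd_layer : H t.*2.+1 0 =
    (step X (foldl (step X) (h0, 0) (mkseq c t)) (c t)).2.
  rewrite layerE layer_program /program_bias /= odd_double /= doubleK IH2.
  by rewrite mul0mx add0r addrA.
split; last exact: odd_layer.
have -> : H t.*2.+2 0 = emit (c t) *m H t.*2.+1 0 + H t.*2 0.
  rewrite layerE layer_program /program_bias /= odd_double /= uphalf_double.
  by rewrite mul0mx mul1mx addr0 add0r.
by rewrite odd_layer IH1 addrC.
Qed.

Lemma network_program (s : seq instruction) : exists theta, forall X,
  network h0 eta A0 B0 (size s).*2 K theta X = (foldl (step X) (h0, 0) s).1.
Proof.
exists (program_params (nth skip s)) => X; rewrite /network /hidden.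
by rewrite (history_program _ X _).1 mkseq_nth.
Qed.

End Programs.

(** * Programs computing polynomial maps *)

Section Polynomials.
Context {R : realType} {n : nat}.
Variable i0 : 'I_n.
Implicit Types (w : seq ('I_n * 'I_n)) (X : 'M[R]_n) (v : 'cV[R]_n).

Definition monomial w X : R := \prod_(ij <- w) X ij.1 ij.2.

(** This is how a layer multiplies a stored scalar by an entry of X. *)
Lemma delta_mx_entry X i j :
  delta_mx i0 i *m (X *m delta_mx j 0) = X i j *: delta_mx i0 0 :> 'cV[R]_n.
Proof.
rewrite -(mul_delta_mx (0 : 'I_1)) -mulmxA [delta_mx 0 i *m _]mulmxA -rowE -colE.
by rewrite [col j _]mx11_scalar !mxE mul_mx_scalar.
Qed.

Definition load_one : @instruction R n := Instruction (delta_mx i0 0) 0 0 0.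

(** The stored scalar is moved from coordinate i0 to the coordinate that X must
read, multiplied by the entry of X, and stored again at coordinate i0. *)
Definition times_entry (ij : 'I_n * 'I_n) : seq (@instruction R n) :=
  [:: Instruction 0 (delta_mx ij.2 i0) 0 0;
      Instruction 0 0 (delta_mx i0 ij.1) 0].

Definition add_multiple v : @instruction R n :=
  Instruction 0 1%:M 0 (v *m delta_mx 0 i0).

Definition term_program (t : 'cV[R]_n * seq ('I_n * 'I_n)) :=
  load_one :: flatten (map times_entry t.2) ++ [:: add_multiple t.1].

Lemma run_times_entries X s c w :
  foldl (step X) (s, c *: delta_mx i0 0) (flatten (map times_entry w)) =
  (s, (c * monomial w X) *: delta_mx i0 0).
Proof.
rewrite /monomial; elim: w c => [|[i j] w IH] c; first by rewrite big_nil mulr1.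
rewrite big_cons mulrA -IH /= /step /=; congr (foldl _ (_, _) _).
  by rewrite !mul0mx !addr0.
rewrite !mul0mx !add0r !addr0 -!scalemxAr mul_delta_mx.
by rewrite delta_mx_entry scalerA.
Qed.

Lemma run_term_program X s t :
  (foldl (step X) s (term_program t)).1 = s.1 + monomial t.2 X *: t.1.
Proof.
rewrite /term_program /= foldl_cat /=.
have -> : step X s load_one = (s.1, 1 *: delta_mx i0 0).
  by rewrite /step /= !mul0mx !addr0 scale1r.
rewrite run_times_entries mul1r /= mul0mx add0r addr0 mul1mx -scalemxAr.
by rewrite -mulmxA mul_delta_mx [delta_mx 0 0]mx11_scalar mxE mulmx1.
Qed.

Lemma run_polynomial_program X s (p : seq ('cV[R]_n * seq ('I_n * 'I_n))) :
  (foldl (step X) s (flatten (map term_program p))).1 =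
  s.1 + \sum_(t <- p) monomial t.2 X *: t.1.
Proof.
elim: p s => [|t p IH] s; first by rewrite big_nil addr0.
by rewrite big_cons addrA -run_term_program -IH /= foldl_cat.
Qed.

(** The leading skip only guarantees a positive depth when p is empty. *)
Lemma network_polynomial (h0 : 'cV[R]_n) (eta : nat -> R) (A0 B0 : base_mx R n)
    (K : nat) (p : seq ('cV[R]_n * seq ('I_n * 'I_n))) : (1 < K)%N ->
  exists L theta, (0 < L)%N /\ forall X,
    network h0 eta A0 B0 L K theta X = h0 + \sum_(t <- p) monomial t.2 X *: t.1.
Proof.
move=> K1; pose s := skip :: flatten (map term_program p).
have [theta E] := network_program h0 eta A0 B0 K1 s.
exists (size s).*2, theta; split => // X; rewrite E.
by rewrite [foldl _ _ _]/= run_polynomial_program /= mul0mx addr0.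
Qed.

End Polynomials.

(** * Density of polynomial maps on a compact set of matrices *)

Lemma compact_set_type (T : topologicalType) (Z : set T) :
  compact Z -> compact [set: Z].
Proof.
move=> cZ F FF _; have FZ : F (set_val @^-1` Z).
  by apply: filterS filterT => x _; exact: set_valP.
have [p [Zp clp]] := cZ _ (fmap_proper_filter _ FF) FZ.
exists (SigSub (mem_set Zp)); split=> // A B FA [_ [[U oU <-] Up UB]].
have FA' : F (set_val @^-1` (set_val @` A)).
  by apply: filterS FA => x Ax; exists x.
have [x [[y Ay <-] Uy]] := clp _ _ FA' (open_nbhs_nbhs (conj oU Up)).
by exists y; split=> //; exact: UB.
Qed.

Section Density.
Context {R : realType} {n : nat}.
Variable Z : set 'M[R]_n.
Hypothesis compactZ : compact Z.

Definition polynomials : set (Z -> R) :=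
  [set f | exists p : seq (R * seq ('I_n * 'I_n)),
    f = fun x => \sum_(t <- p) monomial t.2 (set_val x) * t.1].

Lemma polynomials_entry i j : polynomials (fun x => set_val x i j).
Proof.
exists [:: (1, [:: (i, j)])]; apply/funext => x.
by rewrite /monomial !big_seq1 mulr1.
Qed.

Lemma polynomials_cst c : polynomials (fun=> c).
Proof.
exists [:: (c, [::])]; apply/funext => x.
by rewrite /monomial big_seq1 big_nil mul1r.
Qed.

Lemma polynomialsD f g : polynomials f -> polynomials g -> polynomials (f \+ g).
Proof.
by move=> [p ->] [q ->]; exists (p ++ q); apply/funext => x; rewrite big_cat.
Qed.

Lemma polynomialsM f g : polynomials f -> polynomials g -> polynomials (f \* g).
Proof.
move=> [p ->] [q ->]; exists [seq (s.1 * t.1, s.2 ++ t.2) | s <- p, t <- q].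
apply/funext => x; rewrite big_allpairs_dep /= mulr_suml.
apply: eq_bigr => s _; rewrite mulr_sumr; apply: eq_bigr => t _ /=.
by rewrite /monomial big_cat mulrACA.
Qed.

Lemma polynomials_continuous f : polynomials f -> continuous f.
Proof.
move=> [p ->] x.
apply: (@cvg_bigsum R Z _ (nbhs x) _ R^o p
  (fun y t => monomial t.2 (set_val y) * t.1)) => t.
apply: (@cvgM R Z (nbhs x) _ (fun y => monomial t.2 (set_val y)) (fun=> t.1));
  last exact: cvg_cst.
rewrite /monomial; elim: t.2 => [|[i j] w IH].
  by under eq_fun do rewrite big_nil; rewrite big_nil; exact: cvg_cst.
under eq_fun do rewrite big_cons; rewrite big_cons; apply: cvgM => //.
exact: (continuous_comp (@initial_continuous _ _ set_val x)
  (@coord_continuous _ _ _ i j _)).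
Qed.

Lemma polynomials_dense f : continuous f -> uniform_closure polynomials f.
Proof.
apply: stone_weierstrass.
- exact: compact_set_type.
- exact: polynomials_continuous.
- exact: polynomials_cst.
- exact: polynomialsD.
- exact: polynomialsM.
- move=> x y xy; apply: contrapT => same; apply: xy; apply: val_inj.
  apply/matrixP => i j; apply: contrapT => /eqP xy; apply: same.
  exact: ex_intro2 (polynomials_entry i j) xy.
Qed.

Lemma vector_polynomials_dense (f : Z -> 'cV[R]_n) (e : R) :
  continuous f -> 0 < e -> exists p : seq ('cV[R]_n * seq ('I_n * 'I_n)),
    forall x, `|f x - \sum_(t <- p) monomial t.2 (set_val x) *: t.1| < e.
Proof.
move=> cf e0.
have /fin_all_exists[p pf] i : exists p : seq (R * seq ('I_n * 'I_n)),
    forall x, `|f x i 0 - \sum_(t <- p) monomial t.2 (set_val x) * t.1| < e.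
  have cfi : continuous (fun x => f x i 0).
    by move=> x; exact: (continuous_comp (cf x) (@coord_continuous _ _ _ i 0 _)).
  by have [_ [p ->] fp] := polynomials_dense cfi e0; exists p.
exists [seq (t.1 *: delta_mx i 0, t.2) | i <- enum 'I_n, t <- p i] => x.
suff : ball (f x) e (\sum_(t <- [seq (t.1 *: delta_mx i 0, t.2)
    | i <- enum 'I_n, t <- p i]) monomial t.2 (set_val x) *: t.1).
  by rewrite -ball_normE.
split=> // i j; rewrite ord1 -ball_normE /=.
rewrite big_allpairs_dep /= big_enum summxE (bigD1 i)//=.
rewrite [X in _ - (_ + X)]big1 => [|k ki].
  rewrite addr0 summxE.
  by under eq_bigr do rewrite !mxE eqxx mulr1.
by rewrite summxE big1// => t _; rewrite !mxE eq_sym (negbTE ki) !mulr0.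
Qed.

End Density.

(** * Density of recurrent networks *)

Theorem theorem2p3 (R : realType) (n K : nat) (hn : (0 < n)%N) (hK : (0 < K)%N)
    (h0 : 'cV[R]_n) (eta : nat -> R) (heta : forall l, 0 <= eta l <= 1)
    (A0 B0 : base_mx R n) (Z : set 'M[R]_n) (hZ : compact Z) :
  K = (2 * n + 1)%N ->
  dense [set restrict_cts Z f | f in recurrent_networks h0 eta A0 B0 K].
Proof.
move=> KE; have K1 : (1 < K)%N by rewrite KE addn1 ltnS muln_gt0.
apply/dense_ctsP => f e e0.
have cf : continuous (fun x => f x - h0).
  apply: (@ctsD R Z _ f (fun=> - h0)); last exact: cst_cts.
  exact: (@cts_fun _ _ f).
have [p fp] := vector_polynomials_dense hZ cf e0.
have [L [theta [L0 E]]] :=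
  network_polynomial (Ordinal hn) h0 eta A0 B0 p K1.
exists (restrict_cts Z (network h0 eta A0 B0 L K theta)).
  by exists (network h0 eta A0 B0 L K theta) => //; exists L, theta.
by move=> x; rewrite restrict_ctsE /= E opprD addrA.
Qed.
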